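(* Let $T>0$, let $a,b,c:(0,T)\times(0,1)\to\mathbb{R}$ and $f:(0,T]\times(0,1)\to\mathbb{R}$ be functions with $\sup_{0<x<1,\,0<t\le T}|f(t,x)|<+\infty$. Let $u\in C^0([0,T]\times[0,1])$ be such that $u[t]\in C^2((0,1))$ for almost all $t\in(0,T)$, the derivative $\frac{\partial u}{\partial t}(t,x)$ exists and is a continuous function on $(0,T)\times[0,1]$, the derivatives $\frac{\partial u}{\partial x}(t,0)$, $\frac{\partial u}{\partial x}(t,1)$ exist for all $t\in(0,T]$, and $$\frac{\partial u}{\partial t}(t,x)=a(t,x)\frac{\partial^2u}{\partial x^2}(t,x)+b(t,x)\frac{\partial u}{\partial x}(t,x)+c(t,x)u(t,x)+f(t,x)$$ for almost all $t\in(0,T)$ and for all $x\in(0,1)$. Suppose that $a(t,x)\ge 0$ for all $t\in(0,T)$, $x\in(0,1)$, and that there exist a constant $\sigma>0$ and a positive function $\eta\in C^2([0,1];(0,+\infty))$ such that $$a(t,x)\eta''(x)+b(t,x)\eta'(x)+(\sigma+c(t,x))\eta(x)\le 0\quad\text{for all } t\in(0,T),\ x\in(0,1).$$ Then for all $\zeta\in[0,\sigma)$, all functions $g_0,g_1:(0,T]\to(0,+\infty)$, $k_0,k_1:(0,T]\to[1,+\infty)$ and all $t\in(0,T]$: $$\|u[t]\|_{\infty,\eta}\le\max\left(\exp(-\zeta t)\|u[0]\|_{\infty,\eta},\ \sup_{0<s\le t}\left(\max\left(r_0(s),r_1(s),\frac{\|f[s]\|_{\infty,\eta}}{\sigma-\zeta}\right)\exp(-\zeta(t-s))\right)\right),$$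 where $\|u[t]\|_{\infty,\eta}:=\max_{0\le x\le1}\frac{|u(t,x)|}{\eta(x)}$, $\|f[t]\|_{\infty,\eta}:=\sup_{0<x<1}\frac{|f(t,x)|}{\eta(x)}$, and for $t\in(0,T]$ $$r_0(t):=\min\left(\frac{|u(t,0)|}{\eta(0)},\ \frac{g_0(t)}{\eta(0)}\left|\frac{\partial u}{\partial x}(t,0)-\left(\frac{\eta'(0)}{\eta(0)}+\frac{k_0(t)}{g_0(t)}\right)u(t,0)\right|\right),$$ $$r_1(t):=\min\left(\frac{|u(t,1)|}{\eta(1)},\ \frac{g_1(t)}{\eta(1)}\left|\frac{\partial u}{\partial x}(t,1)-\left(\frac{\eta'(1)}{\eta(1)}-\frac{k_1(t)}{g_1(t)}\right)u(t,1)\right|\right).$$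
   Context: For a function $u$ of $(t,x)$, $u[t]$ denotes the profile at time $t$, i.e. $(u[t])(x)=u(t,x)$; similarly for $f[t]$. $C^k(U;\Omega)$ denotes the class of functions on $U$ with values in $\Omega$ having continuous derivatives up to order $k$ on $U$; $C^k(U)=C^k(U;\mathbb{R})$. ''Almost all'' refers to Lebesgue measure. $\eta',\eta''$ are derivatives with respect to $x\in[0,1]$. The derivatives $\frac{\partial u}{\partial x}(t,0)$ and $\frac{\partial u}{\partial x}(t,1)$ at the boundary points are one-sided derivatives. *)

(* Defs.v *)
From HB Require Import structures.
From mathcomp Require Import all_boot all_order all_algebra.
From mathcomp Require Import all_classical all_reals all_analysis.

Set Implicit Arguments.
Unset Strict Implicit.
Unset Printing Implicit Defensive.

Import Order.TTheory GRing.Theory Num.Theory.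
Import numFieldNormedType.Exports.

Local Open Scope classical_set_scope.
Local Open Scope ring_scope.

(* The difference quotient only sees the values of f on U: at an endpoint of
   U = `[0, 1] this is the one-sided derivative, and at an interior point of U
   it is the usual derivative (derivable_inE and derive_inE below). *)
Definition derivable_in (R : realType) (U : set R) (f : R -> R) (x : R) : Prop :=
  cvg ((f y - f x) / (y - x) @[y --> within U x^']).

Definition derive_in (R : realType) (U : set R) (f : R -> R) (x : R) : R :=
  lim ((f y - f x) / (y - x) @[y --> within U x^']).

Definition is_Ck (R : realType) (k : nat) (U : set R) (f : R -> R) : Prop :=
  (forall j, (j < k)%N ->
     forall x, U x -> derivable_in U (iter j (derive_in U) f) x) /\
  (forall j, (j <= k)%N -> {within U, continuous (iter j (derive_in U) f)}).

(* For U = `[0, 1] and v, eta continuous the supremum is attained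
   (wnorm_max below). *)
Definition wnorm (R : realType) (eta : R -> R) (U : set R) (v : R -> R) : R :=
  sup [set `|v x| / eta x | x in U].

Definition r_left (R : realType) (eta : R -> R) (g k : R -> R)
    (u : R -> R -> R) (t : R) : R :=
  Num.min (`|u t 0| / eta 0)
    (g t / eta 0 *
     `|derive_in `[0, 1] (u t) 0
       - (derive_in `[0, 1] eta 0 / eta 0 + k t / g t) * u t 0|).

Definition r_right (R : realType) (eta : R -> R) (g k : R -> R)
    (u : R -> R -> R) (t : R) : R :=
  Num.min (`|u t 1| / eta 1)
    (g t / eta 1 *
     `|derive_in `[0, 1] (u t) 1
       - (derive_in `[0, 1] eta 1 / eta 1 - k t / g t) * u t 1|).

Lemma within_dnbhs_interior (R : realType) (U : set R) (x : R) :
  nbhs x U -> within U x^' = x^'.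
Proof.
move=> Ux; rewrite eqEsubset; split=> A.
- rewrite /within /= => H; have Ux' : \forall y \near x^', U y by exact: nbhs_dnbhs.
  by apply: filterS2 Ux' H => y Uy; apply.
- by apply: filterS => y Ay _.
Qed.

Lemma dnbhs_quotientE (R : realType) (f : R -> R) (x : R) :
  (f y - f x) / (y - x) @[y --> x^'] =
  h^-1 *: (f (h + x) - f x) @[h --> 0^'].
Proof.
rewrite funeqE => A; rewrite propeqE.
split; rewrite /= !nbhs_simpl /= /dnbhs /within /=.
- move=> /(iffLR (@nbhs0P R R^o _ _)); apply: filterS => h /= + h0.
  rewrite -subr_eq0 addrAC subrr add0r => /(_ h0).
  by rewrite [_ *: _]mulrC (addrC h).
- move=> H; apply/(@nbhs0P R R^o); move: H; apply: filterS => h /= hA.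
  rewrite -subr_eq0 addrAC subrr add0r => /hA.
  by rewrite [_ *: _]mulrC (addrC h).
Qed.

Lemma derivable_inE (R : realType) (U : set R) (f : R -> R) (x : R) :
  nbhs x U -> derivable_in U f x <-> derivable f x 1.
Proof.
move=> Ux; rewrite /derivable_in within_dnbhs_interior// dnbhs_quotientE.
rewrite /derivable; set d := fun h => _; set d' := fun h => _.
by suff -> : d = d' by []; rewrite funeqE => h; rewrite /d /d' /= [h%:A]mulr1.
Qed.

Lemma derive_inE (R : realType) (U : set R) (f : R -> R) (x : R) :
  nbhs x U -> derive_in U f x = derive1 f x.
Proof.
by move=> Ux; rewrite /derive_in within_dnbhs_interior// dnbhs_quotientE.
Qed.

Lemma wnorm_max (R : realType) (eta v : R -> R) :
  {within `[0, 1], continuous v} -> {within `[0, 1], continuous eta} ->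
  (forall x, x \in `[0, 1] -> 0 < eta x) ->
  exists2 x, x \in `[0, 1] &
    wnorm eta `[0, 1] v = `|v x| / eta x /\
    forall y, y \in `[0, 1] -> `|v y| / eta y <= `|v x| / eta x.
Proof.
move=> cv ce e0.
have cq : {within `[0, 1], continuous (fun x => `|v x| / eta x)}.
  apply/subspace_continuousP => x x01; apply: cvgM.
    by apply: cvg_norm; move: x x01; apply/subspace_continuousP.
  apply: cvgV; first by rewrite gt_eqF// e0.
  by move: x x01; apply/subspace_continuousP.
have [x x01 xmax] := EVT_max ler01 cq.
exists x => //; split=> //; apply/eqP; rewrite eq_le; apply/andP; split.
  apply: ge_sup; first by exists (`|v x| / eta x), x.
  by move=> _ [y y01 <-]; exact: xmax.
apply: ub_le_sup; last by exists x.
by exists (`|v x| / eta x) => _ [y y01 <-]; exact: xmax.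
Qed.

(* Main.v *)
Require Import Defs.
From HB Require Import structures.
From mathcomp Require Import all_boot all_order all_algebra.
From mathcomp Require Import all_classical all_reals all_analysis.
From mathcomp Require Import ring lra.

Set Implicit Arguments.
Unset Strict Implicit.
Unset Printing Implicit Defensive.

Import Order.TTheory GRing.Theory Num.Theory.
Import numFieldNormedType.Exports.

Local Open Scope classical_set_scope.
Local Open Scope ring_scope.

(** The claim is a maximum principle for [w s x = exp (zeta * s) * u s x / eta x]:
    if [M] is the right-hand side, it says that [|w|] cannot exceed
    [K = M * exp (zeta * t)] at time [t].  Initially [|w| <= K] by the choice of
    [M].  Consider a time [s] at which [|w s|] has its maximum at [x] with
    [|w s x| > K], and put [V = |u s x| / eta x], [e = sg (u s x)].  Then
    [e * u s] lies below [V * eta] on [[0, 1]] and touches it at [x].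

    If [x] were an end point, the one-sided slopes at the touching point would
    give [V <= r_left] or [V <= r_right] ([le_r_left], [le_r_right]), hence
    [|w s x| <= K].  So [x] is interior; the first and second derivatives of
    [e * u s] and [V * eta] compare there, and the differential inequality for
    [eta] gives [e * (u_t - f) <= - sigma * V * eta x]
    ([elliptic_le_at_touching]).  Bounding [f] by [M] as well, [|w|] decreases
    in time at [(s, x)], at rate at least [(sigma - zeta) * (|w s x| - K)].

    The equation only holds at almost all times, and the maximizer moves with
    time.  [sup_norm_le_of_decay] deals with both: because [u_t] is continuous
    up to [x = 0] and [x = 1], a single good time just after the last time at
    which a level [K' > K] is respected already gives a contradiction. *)

(** * One-variable calculus *)

Lemma exists_between2 (R : realType) (a b c : R) :
  a < b -> a < c -> exists2 r, a < r & r < b /\ r < c.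
Proof.
by move=> ab ac; case: (leP b c) => ?; [exists ((a + b) / 2)|exists ((a + c) / 2)];
  do ?split; lra.
Qed.

(** Near an interior point of [U] the difference quotients restricted to [U] are
    the usual ones, so both derivatives of a [C^2] function can be handled with
    the calculus of two-sided derivatives. *)
Lemma is_Ck2_is_derive (R : realType) (U : set R) (f : R -> R) (x : R) :
  is_Ck 2 U f -> nbhs x U ->
  (\forall y \near x, is_derive (y : R) 1 f (derive1 f y)) /\
  is_derive x 1 (derive1 f) (derive1n 2 f x).
Proof.
move=> [dU _] Ux.
have UxE : {near x, derive_in U f =1 derive1 f}.
  by apply: filterS (nbhs_interior Ux) => y; exact: derive_inE.
have deriveP (g : R -> R) (y : R) :
    derivable g y 1 -> is_derive y 1 g (derive1 g y).
  by move=> dg; rewrite derive1E; exact: derivableP.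
split.
  apply: filterS (nbhs_interior Ux) => y Uy; apply: deriveP.
  have Uy' : U y by exact: interior_subset Uy.
  have df : derivable_in U f y by exact: (dU 0%N).
  exact: (iffLR (derivable_inE f Uy) df).
apply: deriveP; apply: near_eq_derivable UxE _.
have Ux' : U x by exact: nbhs_singleton Ux.
have df : derivable_in U (derive_in U f) x by exact: (dU 1%N).
exact: (iffLR (derivable_inE _ Ux) df).
Qed.

(** The first derivative vanishes at a local minimum.  If the second one were
    negative there, [h'] would be negative just to the right of [x], and by the
    mean value theorem [h] would drop below [h x]. *)
Lemma second_derivative_test (R : realType) (h h' : R -> R) (x h'' : R) :
  (\forall y \near x, is_derive (y : R) 1 h (h' y)) -> is_derive x 1 h' h'' ->
  (\forall y \near x, h x <= h y) -> h' x = 0 /\ 0 <= h''.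
Proof.
move=> dh dh' hmin.
have [/= r r_gt0 xr] : \forall y \near x, is_derive (y : R) 1 h (h' y) /\ h x <= h y.
  by near do split.
have itvP y : y \in `](x - r), (x + r)[ -> ball x r y.
  by rewrite in_itv /= /ball /= => /andP[? ?]; rewrite distrC ltr_distl; lra.
have h'x0 : h' x = 0.
  have h0 : is_derive x 1 h 0.
    apply: (@derive1_at_min R h (x - r) (x + r) x).
    - lra.
    - by move=> y /itvP /xr [].
    - by rewrite in_itv /=; lra.
    - by move=> y /itvP /xr [].
  have [hx _] := xr _ (ballxx x r_gt0).
  by rewrite -(@derive_val _ _ _ _ _ _ _ hx) (@derive_val _ _ _ _ _ _ _ h0).
split=> //; rewrite leNgt; apply/negP => h''_lt0.
have [dvh' /= ddh'] := dh'.
have qlt0 : \forall e \near 0^', e^-1 *: (h' (e *: 1 + x) - h' x) < 0.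
  by apply: cvgr_lt h''_lt0; rewrite -ddh'; exact: dvh'.
have [/= s s_gt0 qs] := qlt0.
have [d d_gt0 [d_r d_s]] := exists_between2 r_gt0 s_gt0.
have [y] : exists2 y, y \in `]x, (x + d)[ & h (x + d) - h x = h' y * (x + d - x).
  have dhd y : x <= y <= x + d -> is_derive y 1 h (h' y).
    by move=> ?; have /itvP/xr[] : y \in `](x - r), (x + r)[ by rewrite in_itv /=; lra.
  apply: MVT; first lra.
    by move=> y; rewrite in_itv /= => ?; apply: dhd; lra.
  apply: derivable_within_continuous => y; rewrite in_itv /= => /dhd dhy.
  exact: (@ex_derive _ _ _ _ _ _ _ dhy).
rewrite in_itv /= => /andP[xy yd] hE.
have h'y : h' y < 0.
  have := qs (y - x); rewrite /= [_%:A]mulr1 subrK h'x0 subr0.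
  rewrite sub0r normrN ger0_norm; last lra.
  rewrite /GRing.scale /= pmulr_rlt0 ?invr_gt0; last lra.
  by apply; [lra|rewrite subr_eq0 gt_eqF].
have /itvP/xr[_] : x + d \in `](x - r), (x + r)[ by rewrite in_itv /=; lra.
by apply/negP; rewrite -ltNge -subr_lt0 hE pmulr_llt0//; lra.
Unshelve. all: by end_near.
Qed.

Lemma derive_in_lim (R : realType) (U : set R) (f : R -> R) (x : R)
    (F : set_system R) (FF : Filter F) :
  F --> x^' -> (\forall y \near F, U y) -> derivable_in U f x ->
  (f y - f x) / (y - x) @[y --> F] --> derive_in U f x.
Proof.
move=> Fx FU df; apply: cvg_trans df; apply: cvg_app => P /Fx.
by apply: filterS2 FU => y Uy; exact.
Qed.

(** If [e * f] touches [V * g] from below at the left end of an interval, the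
    difference quotients taken from the right are ordered in the same way, and
    the order passes to the limit. *)
Lemma le_derive_in_right (R : realType) (U : set R) (f g : R -> R) (x e V : R) :
  (\forall y \near x^'+, U y) -> derivable_in U f x -> derivable_in U g x ->
  e * f x = V * g x -> (forall y, U y -> e * f y <= V * g y) ->
  e * derive_in U f x <= V * derive_in U g x.
Proof.
move=> Ux df dg fgx fg.
have xx : x^'+ --> x^'.
  move=> P; rewrite !nbhs_simpl /at_right /dnbhs /within /=.
  by apply: filterS => y + xy; apply; rewrite gt_eqF.
apply: (@ler_cvg_to _ x^'+ _ R (fun y => e * ((f y - f x) / (y - x)))
  (fun y => V * ((g y - g x) / (y - x)))).
- by apply: cvgMr; exact: derive_in_lim.
- by apply: cvgMr; exact: derive_in_lim.
apply: filterS2 Ux (nbhs_right_gt x) => y Uy xy.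
rewrite !mulrA ler_pM2r ?invr_gt0 ?subr_gt0// !mulrBr fgx lerD2r; exact: fg.
Qed.

(** At the right end the increments [y - x] are negative, which reverses the
    order of the quotients. *)
Lemma le_derive_in_left (R : realType) (U : set R) (f g : R -> R) (x e V : R) :
  (\forall y \near x^'-, U y) -> derivable_in U f x -> derivable_in U g x ->
  e * f x = V * g x -> (forall y, U y -> e * f y <= V * g y) ->
  V * derive_in U g x <= e * derive_in U f x.
Proof.
move=> Ux df dg fgx fg.
have xx : x^'- --> x^'.
  move=> P; rewrite !nbhs_simpl /at_left /dnbhs /within /=.
  by apply: filterS => y + xy; apply; rewrite lt_eqF.
apply: (@ler_cvg_to _ x^'- _ R (fun y => V * ((g y - g x) / (y - x)))
  (fun y => e * ((f y - f x) / (y - x)))).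
- by apply: cvgMr; exact: derive_in_lim.
- by apply: cvgMr; exact: derive_in_lim.
apply: filterS2 Ux (nbhs_left_lt x) => y Uy xy.
rewrite !mulrA ler_nM2r ?invr_lt0 ?subr_lt0// !mulrBr fgx lerD2r; exact: fg.
Qed.

(** * Continuity on a product with a compact factor *)

(** Around each [(t, x)] continuity controls [F] on a product neighbourhood;
    since [B] is compact, one neighbourhood of [t] serves for all [x] in [B].
    This uniformity replaces the continuity in time of the sup norm. *)
Lemma cvg_within_uniform (R : realType) (F : R -> R -> R) (A B : set R) (t e : R) :
  compact B -> {within A `*` B, continuous (fun p : R * R => F p.1 p.2)} ->
  A t -> 0 < e ->
  \forall s \near within A (nbhs t), forall x, B x -> `|F s x - F t x| < e.
Proof.
move=> cB /subspace_continuousP cF At e0.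
have /compact_near_coveringP/near_covering_withinP := cB.
move=> /(_ R (within A (nbhs t)) (fun s x => `|F s x - F t x| < e)); apply.
move=> x Bx; have e20 : 0 < e / 2 by rewrite divr_gt0.
have /cvgrPdist_lt/(_ _ e20) := cF (t, x) (conj At Bx).
move=> [[P Q] /= [Pt Qx] PQ].
exists (Q, [set s | A s /\ P s]).
  by split => //=; rewrite /within /=; apply: filterS Pt => s Ps As; split.
move=> [y s] /= [Qy [As Ps]] By.
have := PQ (s, y) (conj Ps Qy) (conj As By).
have := PQ (t, y) (conj (nbhs_singleton Pt) Qy) (conj At By).
rewrite /from_subspace /= !ltr_distl => /andP[? ?] /andP[? ?]; lra.
Qed.

Lemma within_continuous_slice (R : realType) (F : R -> R -> R) (A B : set R) (t : R) :
  {within A `*` B, continuous (fun p : R * R => F p.1 p.2)} -> A t ->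
  {within B, continuous (F t)}.
Proof.
move=> /subspace_continuousP cF At; apply/subspace_continuousP => x Bx.
apply: (@cvg_comp _ _ _ (fun y => (t, y)) (fun p => F p.1 p.2) _
  (within (A `*` B) (nbhs (t, x)))); last exact: cF (t, x) (conj At Bx).
move=> P [[P1 Q1] /= [Pt Qx] PQ].
rewrite /within /=; apply: filterS Qx => y Qy By.
by apply: (PQ (t, y)); split => //; exact: nbhs_singleton Pt.
Qed.

Lemma within_continuous_slice_l (R : realType) (F : R -> R -> R) (A B : set R) (x : R) :
  compact B -> {within A `*` B, continuous (fun p : R * R => F p.1 p.2)} -> B x ->
  {within A, continuous (fun s => F s x)}.
Proof.
move=> cB cF Bx; apply/subspace_continuousP => t At; apply/cvgrPdist_lt => e e0.
have := cvg_within_uniform cB cF At e0.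
by apply: filterS => s /(_ x Bx); rewrite distrC.
Qed.

Lemma weighted_continuous (R : realType) (zeta : R) (eta : R -> R)
    (A : set R) (F : R -> R -> R) :
  {within `[0, 1], continuous eta} -> (forall x, x \in `[0, 1] -> 0 < eta x) ->
  {within A `*` `[0, 1], continuous (fun p : R * R => F p.1 p.2)} ->
  {within A `*` `[0, 1],
    continuous (fun p : R * R => expR (zeta * p.1) * (F p.1 p.2 / eta p.2))}.
Proof.
move=> /subspace_continuousP eC e0 /subspace_continuousP FC.
apply/subspace_continuousP => -[t x] Atx; have [At Ix] := Atx.
have fstC : p.1 @[p --> within (A `*` `[0, 1]) (nbhs (t, x))] --> t.
  by apply: cvg_within_filter; exact: cvg_fst.
apply: cvgM.
  apply: continuous_cvg; first exact: continuous_expR.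
  by apply: cvgMr.
apply: cvgM; first exact: FC.
apply: cvgV; first by rewrite gt_eqF// e0.
apply: (@cvg_comp _ _ _ snd eta _ (within `[0, 1] (nbhs x))); last exact: eC.
move=> P; rewrite /= /within /= => Px.
exists (setT, fun y => (`[0, 1]%classic : set R) y -> P y).
  by split => //; exact: filterT.
by move=> [r y] /= [_ +] [_ Iy]; exact.
Qed.

(** * Decay of the sup norm from an almost-everywhere inequality *)

Lemma ae_exists_itv (R : realType) (P : R -> Prop) (a b : R) :
  {ae lebesgue_measure, forall t : R, P t} -> a < b -> exists2 t, t \in `]a, b[ & P t.
Proof.
move=> [N [mN N0 NP]] ab; apply: contrapT => nP.
have : (lebesgue_measure `]a, b[%classic <= lebesgue_measure N)%E.
  apply: le_measure; rewrite ?inE//.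
  by move=> t tab; apply: NP => Pt; apply: nP; exists t.
by rewrite N0 lebesgue_measure_itv /= lte_fin ab -EFinD lee_fin subr_le0 leNgt ab.
Qed.
(** Suppose [|w S x0| > K] and fix a level [K'] strictly between.  Let [m] be the
    last time at which [|w| <= K'] on the whole of [[0, 1]]; then [0 < m < S].
    Every later time [s] has a maximizer [x] of [|w s|] with [|w s x| > K'], and
    at almost all of them [sg (w s x) * wt s x < - kappa * (K' - K)].  But [|w|]
    has grown at this fixed [x] between [m] and [s], so by the mean value theorem
    [sg (w s x) * wt] is positive at an intermediate time.  Since [wt] is
    continuous at time [m], uniformly in [x], its values at the two times are
    too close for this once [s] is near [m].  Only one good time [s] close to
    [m] is required, so the exceptional null set is harmless and the sup norm
    never has to be differentiated. *)
Lemma sup_norm_le_of_decay (R : realType) (w wt : R -> R -> R) (S K kappa : R) :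
  0 <= S -> 0 < kappa ->
  {within `[0, S] `*` `[0, 1], continuous (fun p : R * R => w p.1 p.2)} ->
  (forall s x, s \in `]0, S[ -> x \in `[0, 1] ->
    is_derive s 1 (fun r => w r x) (wt s x)) ->
  {within `]0, S[ `*` `[0, 1], continuous (fun p : R * R => wt p.1 p.2)} ->
  (forall x, x \in `[0, 1] -> `|w 0 x| <= K) ->
  {ae lebesgue_measure, forall s : R, s \in `]0, S[ ->
    forall x, x \in `[0, 1] ->
      (forall y, y \in `[0, 1] -> `|w s y| <= `|w s x|) -> K < `|w s x| ->
      Num.sg (w s x) * wt s x <= - kappa * (`|w s x| - K)} ->
  forall x, x \in `[0, 1] -> `|w S x| <= K.
Proof.
move=> S0 kappa0 wC wd wtC w0 decay x0 x001; rewrite leNgt; apply/negP => wSx0.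
have cI : compact (`[0, 1]%classic : set R) by exact: segment_compact.
have [K' KK' K'w] : exists2 K', K < K' & K' < `|w S x0|.
  by exists ((K + `|w S x0|) / 2); [rewrite ltr_pdivlMr// | rewrite ltr_pdivrMr//]; lra.
pose A := [set s : R | s \in `[0, S] /\ forall x, x \in `[0, 1] -> `|w s x| <= K'].
have A0 : A 0.
  split; first by rewrite in_itv /= lexx.
  by move=> x /w0 wK; apply: le_trans wK (ltW KK').
have Aub : has_ubound A by exists S => s [/itvP->].
have Asup : has_sup A by split => //; exists 0.
have [m [m_ub m_adh m_leS]] : exists m, [/\ forall s, A s -> s <= m,
    forall e, 0 < e -> exists2 s, A s & m - e < s & m <= S].
  exists (sup A); split=> [s As|e e0|]; first exact: ub_le_sup.
    by have [s As ms] := sup_adherent e0 Asup; exists s.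
  by apply: ge_sup; [exists 0|move=> s [/itvP->]].
have m_ge0 : 0 <= m by exact: m_ub.
have m0S : m \in `[0, S] by rewrite in_itv /= m_ge0.
have wU s e : s \in `[0, S] -> 0 < e -> exists2 d, 0 < d &
    forall r, r \in `[0, S] -> `|s - r| < d ->
    forall x, x \in `[0, 1] -> `|w r x - w s x| < e.
  move=> sS e0; have [d /= d0 sd] := cvg_within_uniform cI wC sS e0.
  by exists d => // r rS rd; exact: sd.
have Am : A m.
  split=> // x x01; rewrite leNgt; apply/negP => K'm.
  have K'm0 : 0 < `|w m x| - K' by rewrite subr_gt0.
  have [d d0 dm] := wU m _ m0S K'm0.
  have [s As ms] := m_adh d d0; have [sS sK] := As.
  have sm : s <= m by exact: m_ub.
  have smd : `|m - s| < d by rewrite ger0_norm ?subr_ge0//; lra.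
  have := dm s sS smd x x01.
  have := sK x x01; have := lerB_dist (w m x) (w s x); rewrite distrC; lra.
have mS : m < S.
  move: m_leS; rewrite le_eqVlt => /orP[/eqP mE|//].
  by have [_ /(_ x0 x001)] := Am; rewrite mE leNgt K'w.
have afterm s : m < s -> s <= S -> exists2 x, x \in `[0, 1] & K' < `|w s x|.
  move=> ms sS; apply: contrapT => nx.
  suff /m_ub : A s by rewrite leNgt ms.
  split; first by rewrite in_itv /= sS (le_trans m_ge0 (ltW ms)).
  by move=> x x01; rewrite leNgt; apply/negP => K'x; apply: nx; exists x.
have m0 : 0 < m.
  have KK'0 : 0 < K' - K by rewrite subr_gt0.
  have S00 : 0 \in `[0, S] by rewrite in_itv /= lexx.
  have [d d0 dw] := wU 0 _ S00 KK'0.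
  rewrite ltNge; apply/negP => m0.
  have [s s0 [sd sS]] : exists2 s, 0 < s & s < d /\ s <= S.
    have [s ? [? ?]] := exists_between2 d0 (le_lt_trans m_ge0 mS).
    by exists s => //; split => //; exact: ltW.
  have [x x01] := afterm s (le_lt_trans m0 s0) sS.
  have := dw s _ _ x x01; rewrite in_itv /= (ltW s0) sS sub0r normrN ger0_norm ?(ltW s0)//.
  by move=> /(_ isT sd); have := w0 x x01; have := lerB_dist (w s x) (w 0 x); lra.
have m0S' : m \in `]0, S[ by rewrite in_itv /= m0.
pose delta := kappa * (K' - K).
have delta0 : 0 < delta by rewrite mulr_gt0// subr_gt0.
have [d /= d0 dm] := cvg_within_uniform cI wtC m0S' (divr_gt0 delta0 (ltr0n R 2)).
have mmd : m < m + d by rewrite ltrDl.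
have [r mr [rd rS]] := exists_between2 mmd mS.
have [s + good] := ae_exists_itv decay mr.
rewrite in_itv /= => /andP[ms sr].
have sS : s \in `]0, S[ by rewrite in_itv /= (lt_trans m0 ms) (lt_trans sr rS).
have {}good := good sS.
have [x x01 xmax] : exists2 x, x \in `[0, 1] &
    forall y, y \in `[0, 1] -> `|w s y| <= `|w s x|.
  apply: EVT_max => //; apply/subspace_continuousP => x x01; apply: cvg_norm.
  have sS' : s \in `[0, S] by exact: subset_itv_oo_cc.
  by move: x x01; apply/subspace_continuousP; exact: within_continuous_slice wC sS'.
have [y y01 yK'] := afterm s ms (ltW (lt_trans sr rS)).
have xK' := lt_le_trans yK' (xmax y y01).
have {}good := good x x01 xmax (lt_trans KK' xK').
have goods : Num.sg (w s x) * wt s x < - delta.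
  by apply: le_lt_trans good _; rewrite /delta mulNr ltrN2 ltr_pM2l// ltrD2r.
have dw z : m <= z <= s -> is_derive z 1 (fun q => w q x) (wt z x).
  move=> /andP[mz zs]; apply: wd => //; rewrite in_itv /= (lt_le_trans m0 mz).
  exact: le_lt_trans zs (lt_trans sr rS).
have dwoo z : z \in `]m, s[ -> is_derive z 1 (fun q => w q x) (wt z x).
  by rewrite in_itv /= => /andP[mz zs]; apply: dw; rewrite !ltW.
have wCms : {within `[m, s], continuous (fun q => w q x)}.
  apply: derivable_within_continuous => z; rewrite in_itv /= => /dw dwz.
  exact: (@ex_derive _ _ _ _ _ _ _ dwz).
have [z] := @MVT R (fun q => w q x) (fun q => wt q x) m s ms dwoo wCms.
rewrite in_itv /= => /andP[mz zs] wE.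
(* On the right of m the derivative wt varies by less than delta. *)
have wt_m q : m < q -> q <= s -> `|wt q x - wt m x| < delta / 2.
  move=> mq qs; apply: dm => //=.
    by rewrite ltr0_norm ?subr_lt0// opprB ltrBlDl (le_lt_trans qs (lt_trans sr rd)).
  by rewrite in_itv /= (lt_trans m0 mq) (le_lt_trans qs (lt_trans sr rS)).
have := wt_m z mz (ltW zs); have := wt_m s ms (lexx s).
rewrite !ltr_distl => /andP[? ?] /andP[? ?].
have [_ /(_ x x01) wmx] := Am.
have sm0 : 0 < s - m by rewrite subr_gt0.
have K_ge0 : 0 <= K := le_trans (normr_ge0 _) (w0 x x01).
have K'_ge0 := le_lt_trans K_ge0 KK'.
move: wmx; rewrite ler_norml => /andP[wmx1 wmx2].
move: goods xK'; case: (sgrP (w s x)) => ws; rewrite ?mul1r ?mulN1r => goods xK'.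
- by have := lt_trans K'_ge0 xK'; rewrite ltxx.
- have : 0 < wt z x * (s - m) by rewrite -wE subr_gt0 (le_lt_trans wmx2).
  by rewrite pmulr_lgt0//; lra.
- have : wt z x * (s - m) < 0 by rewrite -wE subr_lt0 (lt_le_trans _ wmx1)// ltrNr.
  by rewrite pmulr_llt0//; lra.
Qed.

(** * Comparison at a point where the weight touches the solution *)

(** At an interior touching point [V * eta - e * v] has a minimum, so its first
    derivative vanishes and its second one is nonnegative.  As [a >= 0], the
    operator applied to [e * v] is at most [V] times the operator applied to
    [eta], which the hypothesis on [eta] bounds.  Below, [e] is the sign of [v]
    and [V] its weighted norm. *)
Lemma elliptic_le_at_touching (R : realType) (v eta : R -> R) (x a b c e V sigma : R) :
  is_Ck 2 `]0, 1[ v -> is_Ck 2 `[0, 1] eta -> x \in `]0, 1[ -> 0 <= a -> 0 <= V ->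
  a * derive1n 2 eta x + b * derive1 eta x + (sigma + c) * eta x <= 0 ->
  (forall y, y \in `[0, 1] -> e * v y <= V * eta y) -> e * v x = V * eta x ->
  e * (a * derive1n 2 v x + b * derive1 v x + c * v x) <= - sigma * (V * eta x).
Proof.
move=> vC2 etaC2 x01 a0 V0 eta_ineq vle vx.
have Ux : nbhs x (`]0, 1[%classic : set R) by exact: near_in_itvoo.
have Ix : nbhs x (`[0, 1]%classic : set R).
  by apply: filterS Ux => y; exact: subset_itv_oo_cc.
have [dv d2v] := is_Ck2_is_derive vC2 Ux.
have [deta d2eta] := is_Ck2_is_derive etaC2 Ix.
have lincomb (p q : R -> R) (y dp dq : R) : is_derive y 1 p dp ->
    is_derive y 1 q dq -> is_derive y 1 (fun z => V * p z - e * q z) (V * dp - e * dq).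
  move=> dpy dqy.
  exact: (@is_deriveB _ _ _ (V *: p) (e *: q) y 1 (V *: dp) (e *: dq)).
have [] := @second_derivative_test R (fun y => V * eta y - e * v y)
  (fun y => V * derive1 eta y - e * derive1 v y) x
  (V * derive1n 2 eta x - e * derive1n 2 v x).
- apply: filterS2 dv deta => y dvy detay.
  exact: lincomb detay dvy.
- by apply: filterS Ix => y Iy; rewrite vx subrr subr_ge0; exact: vle.
move: eta_ineq vx {vle dv d2v deta d2eta lincomb vC2 etaC2 Ux Ix}.
move: (derive1n 2 v x) (derive1n 2 eta x) (derive1 v x) (derive1 eta x) (v x) (eta x).
move=> v2 eta2 v1 eta1 v0 eta0 eta_ineq v0E h1 h2.
have -> : e * (a * v2 + b * v1 + c * v0) = a * (e * v2) + b * (e * v1) + c * (e * v0).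
  by ring.
have -> : e * v1 = V * eta1 by apply/eqP; rewrite eq_sym -subr_eq0 h1.
have av2 : a * (e * v2) <= a * (V * eta2) by rewrite ler_wpM2l// -subr_ge0.
have Veta : V * (a * eta2 + b * eta1 + (sigma + c) * eta0) <= 0.
  by rewrite mulr_ge0_le0.
by rewrite v0E; lra.
Qed.

(** A touching point at the boundary makes the boundary data large.  The first
    entry of the minimum is then [V] itself.  In the second one, touching gives
    [e * u' <= V * eta'], so the Robin expression times [- e] is at least
    [V * eta 0 * k / g], and [k >= 1]. *)
Lemma le_r_left (R : realType) (eta g k : R -> R) (u : R -> R -> R) (t e V : R) :
  derivable_in `[0, 1] (u t) 0 -> derivable_in `[0, 1] eta 0 ->
  0 < eta 0 -> 0 < g t -> 1 <= k t -> `|e| <= 1 -> 0 <= V ->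
  (forall y, y \in `[0, 1] -> e * u t y <= V * eta y) -> e * u t 0 = V * eta 0 ->
  V <= r_left eta g k u t.
Proof.
move=> du deta eta0 g0 k1 e1 V0 ule u0.
have I0 : \forall y \near 0^'+, (`[0, 1]%classic : set R) y.
  apply: filterS2 (nbhs_right_ge 0) (nbhs_right_le ltr01) => y y0 y1.
  by rewrite /= in_itv /= y0.
have := le_derive_in_right I0 du deta u0 ule.
set u' := derive_in _ (u t) _; set eta' := derive_in _ eta _ => du_le.
have e_le z : e * z <= `|z|.
  by rewrite (le_trans (ler_norm _))// normrM ler_piMl.
rewrite /r_left le_min; apply/andP; split.
  by rewrite ler_pdivlMr// -u0.
rewrite -/u' -/eta' -normrN mulrAC ler_pdivlMr//.
set z := u' - _.
have zE : e * (- z) = - (e * u') + V * eta' + V * eta 0 * k t / g t.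
  have -> : e * - z = - (e * u') + (eta' / eta 0 + k t / g t) * (e * u t 0).
    by rewrite /z; ring.
  by rewrite u0; field; rewrite !gt_eqF.
have : g t * (V * eta 0 * k t / g t) <= g t * `|- z|.
  rewrite ler_pM2l//; apply: le_trans (e_le _); rewrite zE; lra.
have -> : g t * (V * eta 0 * k t / g t) = V * eta 0 * k t by field; rewrite gt_eqF.
by apply: le_trans; rewrite ler_peMr// mulr_ge0// ltW.
Qed.

(** At the other end the slope inequality is reversed, and the sign of [k / g] in
    [r_right] is reversed accordingly. *)
Lemma le_r_right (R : realType) (eta g k : R -> R) (u : R -> R -> R) (t e V : R) :
  derivable_in `[0, 1] (u t) 1 -> derivable_in `[0, 1] eta 1 ->
  0 < eta 1 -> 0 < g t -> 1 <= k t -> `|e| <= 1 -> 0 <= V ->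
  (forall y, y \in `[0, 1] -> e * u t y <= V * eta y) -> e * u t 1 = V * eta 1 ->
  V <= r_right eta g k u t.
Proof.
move=> du deta eta0 g0 k1 e1 V0 ule u1.
have I1 : \forall y \near 1^'-, (`[0, 1]%classic : set R) y.
  apply: filterS2 (nbhs_left_le 1) (nbhs_left_ge ltr01) => y y1 y0.
  by rewrite /= in_itv /= y0.
have := le_derive_in_left I1 du deta u1 ule.
set u' := derive_in _ (u t) _; set eta' := derive_in _ eta _ => du_ge.
have e_le z : e * z <= `|z|.
  by rewrite (le_trans (ler_norm _))// normrM ler_piMl.
rewrite /r_right le_min; apply/andP; split.
  by rewrite ler_pdivlMr// -u1.
rewrite -/u' -/eta' mulrAC ler_pdivlMr//.
set z := u' - _.
have zE : e * z = e * u' - V * eta' + V * eta 1 * k t / g t.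
  have -> : e * z = e * u' - (eta' / eta 1 - k t / g t) * (e * u t 1).
    by rewrite /z; ring.
  by rewrite u1; field; rewrite !gt_eqF.
have : g t * (V * eta 1 * k t / g t) <= g t * `|z|.
  rewrite ler_pM2l//; apply: le_trans (e_le _); rewrite zE; lra.
have -> : g t * (V * eta 1 * k t / g t) = V * eta 1 * k t by field; rewrite gt_eqF.
by apply: le_trans; rewrite ler_peMr// mulr_ge0// ltW.
Qed.

(** * The maximum principle *)

Theorem theorem2p2 (R : realType) (T : R) (a b c f u : R -> R -> R)
  (T_gt0 : 0 < T)
  (f_bounded : has_ubound
     [set z | exists t x, [/\ t \in `]0, T], x \in `]0, 1[ & z = `|f t x|]])
  (u_C0 : {within `[0, T] `*` `[0, 1], continuous (fun p : R * R => u p.1 p.2)})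
  (u_C2 : {ae lebesgue_measure, forall t : R,
     t \in `]0, T[ -> is_Ck 2 `]0, 1[ (u t)})
  (u_dt : forall t x, t \in `]0, T[ -> x \in `[0, 1] ->
     derivable (fun s => u s x) t 1)
  (u_dt_C0 : {within `]0, T[ `*` `[0, 1], continuous
     (fun p : R * R => derive1 (fun s => u s p.2) p.1)})
  (u_dx0 : forall t, t \in `]0, T] -> derivable_in `[0, 1] (u t) 0)
  (u_dx1 : forall t, t \in `]0, T] -> derivable_in `[0, 1] (u t) 1)
  (u_pde : {ae lebesgue_measure, forall t : R, t \in `]0, T[ ->
     forall x, x \in `]0, 1[ ->
       derive1 (fun s => u s x) t =
         a t x * derive1n 2 (u t) x + b t x * derive1 (u t) x + c t x * u t x + f t x})
  (a_ge0 : forall t x, t \in `]0, T[ -> x \in `]0, 1[ -> 0 <= a t x)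
  (sigma : R) (sigma_gt0 : 0 < sigma)
  (eta : R -> R) (eta_C2 : is_Ck 2 `[0, 1] eta)
  (eta_gt0 : forall x, x \in `[0, 1] -> 0 < eta x)
  (eta_ineq : forall t x, t \in `]0, T[ -> x \in `]0, 1[ ->
     a t x * derive1n 2 eta x + b t x * derive1 eta x + (sigma + c t x) * eta x <= 0)
  (zeta : R) (zeta_bnd : zeta \in `[0, sigma[)
  (g0 g1 k0 k1 : R -> R)
  (g0_gt0 : forall t, t \in `]0, T] -> 0 < g0 t)
  (g1_gt0 : forall t, t \in `]0, T] -> 0 < g1 t)
  (k0_ge1 : forall t, t \in `]0, T] -> 1 <= k0 t)
  (k1_ge1 : forall t, t \in `]0, T] -> 1 <= k1 t)
  (t : R) (t_bnd : t \in `]0, T]) :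
  wnorm eta `[0, 1] (u t) <=
    Num.max (expR (- zeta * t) * wnorm eta `[0, 1] (u 0))
      (sup [set Num.max (Num.max (r_left eta g0 k0 u s) (r_right eta g1 k1 u s))
                        (wnorm eta `]0, 1[ (f s) / (sigma - zeta))
                * expR (- zeta * (t - s)) | s in `]0, t] ]).
Proof.
have tT := t_bnd; rewrite in_itv /= in tT; have {tT} [t_gt0 tT] := andP tT.
have [zeta_ge0 zeta_lt] : 0 <= zeta /\ zeta < sigma.
  by apply/andP; rewrite in_itv /= in zeta_bnd.
have sz_gt0 : 0 < sigma - zeta by rewrite subr_gt0.
have itv0T s : s \in `]0, T] -> s \in `[0, T] by exact: subset_itv_oc_cc.
have itvt s : s \in `]0, t] -> s \in `]0, T].
  by rewrite !in_itv /= => /andP[-> /le_trans]; apply.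
have I0 : (0 : R) \in `[0, 1] by rewrite in_itv /= lexx ler01.
have I1 : (1 : R) \in `[0, 1] by rewrite in_itv /= lexx ler01.
have cI : compact (`[0, 1]%classic : set R) by exact: segment_compact.
have eta_C : {within `[0, 1], continuous eta} := eta_C2.2 0%N isT.
have eta_d x : x \in `[0, 1] -> derivable_in `[0, 1] eta x := eta_C2.1 0%N isT x.
have uC s : s \in `[0, T] -> {within `[0, 1], continuous (u s)}.
  exact: within_continuous_slice u_C0.
have ule s x : s \in `[0, T] -> x \in `[0, 1] ->
    `|u s x| / eta x <= wnorm eta `[0, 1] (u s).
  move=> sT x01; have [y _ [-> ymax]] := wnorm_max (uC s sT) eta_C eta_gt0.
  exact: ymax.
have [Cf [Cf_ge0 Cf_ub]] : exists C, 0 <= C /\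
    forall s x, s \in `]0, T] -> x \in `]0, 1[ -> `|f s x| / eta x <= C.
  have [F Fub] := f_bounded.
  have [y y01 ymin] := EVT_min ler01 eta_C; have y0 := eta_gt0 y y01.
  exists (Num.max F 0 / eta y); split.
    by rewrite divr_ge0 ?(ltW y0)// le_max lexx orbT.
  move=> s x sT x01; have x01' := subset_itv_oo_cc x01.
  have i0 : 0 <= (eta x)^-1 by rewrite invr_ge0 ltW// eta_gt0.
  apply: (ler_pM (normr_ge0 _) i0).
    by rewrite le_max; apply/orP; left; apply: Fub; exists s, x.
  by rewrite lef_pV2 ?posrE ?eta_gt0//; exact: ymin.
have half01 : (2^-1 : R) \in `]0, 1[ by rewrite in_itv /=; lra.
have fle_ub s : s \in `]0, T] -> wnorm eta `]0, 1[ (f s) <= Cf.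
  move=> sT; apply: ge_sup; first by exists (`|f s 2^-1| / eta 2^-1), 2^-1.
  by move=> _ [x x01 <-]; exact: Cf_ub.
have fle s x : s \in `]0, T] -> x \in `]0, 1[ ->
    `|f s x| / eta x <= wnorm eta `]0, 1[ (f s).
  move=> sT x01; apply: ub_le_sup; last by exists x.
  by exists Cf => _ [y y01 <-]; exact: Cf_ub.
pose B s := Num.max (Num.max (r_left eta g0 k0 u s) (r_right eta g1 k1 u s))
                    (wnorm eta `]0, 1[ (f s) / (sigma - zeta)).
(* The supremum in the statement is that of a bounded set, so that its elements
   are below it: the minima in r_left and r_right are controlled by their first
   entries, which are continuous in time. *)
have [C [C_ge0 C_ub]] : exists C, 0 <= C /\ forall s, s \in `]0, T] -> B s <= C.
  have bndx x : x \in `[0, 1] -> exists2 C, 0 <= C &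
      forall s, s \in `[0, T] -> `|u s x| / eta x <= C.
    move=> x01; have /subspace_continuousP uxC := within_continuous_slice_l cI u_C0 x01.
    have [|r rT rmax] := @EVT_max R (fun s => `|u s x|) 0 T (ltW T_gt0).
      by apply/subspace_continuousP => s sT; apply: cvg_norm; exact: uxC.
    exists (`|u r x| / eta x); first by rewrite divr_ge0// ltW// eta_gt0.
    by move=> s sT; rewrite ler_pM2r ?invr_gt0 ?eta_gt0//; exact: rmax.
  have [C0 C0_ge0 C0P] := bndx 0 I0; have [C1 C1_ge0 C1P] := bndx 1 I1.
  exists (Num.max (Num.max C0 C1) (Cf / (sigma - zeta))); split.
    by rewrite !le_max C0_ge0.
  move=> s sT; rewrite /B !ge_max !le_max !ge_min.
  rewrite C0P ?itv0T//= C1P ?itv0T//= ler_pM2r ?invr_gt0// fle_ub// !orbT.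
  by [].
set M := Num.max _ _.
have B_le s : s \in `]0, t] -> B s * expR (- zeta * (t - s)) <= M.
  move=> st; rewrite le_max; apply/orP; right; apply: ub_le_sup; last by exists s.
  exists C => _ [r rt <-]; rewrite -/(B r).
  have e1 : expR (- zeta * (t - r)) <= 1.
    rewrite -expR0 ler_expR mulNr oppr_le0 mulr_ge0// subr_ge0.
    by move: rt; rewrite /= in_itv /= => /andP[].
  apply: (@le_trans _ _ (C * expR (- zeta * (t - r)))).
    by rewrite ler_pM2r ?expR_gt0// C_ub// itvt.
  by rewrite ler_piMr.
(* The factor exp(zeta * s) turns the moving bound M * exp(zeta * (t - s)) into
   the constant K. *)
pose K := M * expR (zeta * t).
have u0_le : wnorm eta `[0, 1] (u 0) <= K.
  rewrite /K -ler_pdivrMr ?expR_gt0// -expRN -mulNr mulrC.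
  by rewrite le_max lexx.
have B_leK s : s \in `]0, t] -> expR (zeta * s) * B s <= K.
  move=> st; rewrite /K -ler_pdivrMr ?expR_gt0// -expRN.
  apply: le_trans (B_le s st); rewrite mulrAC -expRD mulrC.
  by rewrite (_ : zeta * s - zeta * t = - zeta * (t - s))//; ring.
have T0 : (0 : R) \in `[0, T] by rewrite in_itv /= lexx ltW.
have K_ge0 : 0 <= K.
  apply: le_trans u0_le; apply: le_trans (ule 0 0 T0 I0).
  by rewrite divr_ge0// ltW// eta_gt0.
pose w s x := expR (zeta * s) * (u s x / eta x).
pose wt s x := expR (zeta * s) * ((zeta * u s x + derive1 (fun r => u r x) s) / eta x).
have normw s x : x \in `[0, 1] -> `|w s x| = expR (zeta * s) * (`|u s x| / eta x).
  move=> x01; rewrite /w !normrM normfV (gtr0_norm (expR_gt0 _)).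
  by rewrite (gtr0_norm (eta_gt0 x x01)).
have oo_sub s : s \in `]0, t[ -> s \in `]0, T[.
  by rewrite !in_itv /= => /andP[-> /lt_le_trans]; apply.
have w_le : forall x, x \in `[0, 1] -> `|w t x| <= K.
  apply: (@sup_norm_le_of_decay R w wt t K (sigma - zeta)) => //.
  - exact: ltW.
  - apply: (@weighted_continuous R zeta eta _ u eta_C eta_gt0).
    apply: continuous_subspaceW u_C0 => -[s x] [/= st x01]; split => //=.
    exact: (subset_itvl _ st).
  - move=> s x st x01; have sT := oo_sub s st.
    have du : is_derive s 1 (fun r => u r x) (derive1 (fun r => u r x) s).
      by rewrite derive1E; apply: derivableP; exact: u_dt.
    rewrite /w /wt; apply: is_derive_eq.
    by rewrite scaler0 add0r /GRing.scale /=; ring.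
  - apply: (@weighted_continuous R zeta eta _
      (fun s x => zeta * u s x + derive1 (fun r => u r x) s)) => //.
    apply/subspace_continuousP => -[s x] [/= st x01].
    have oo_subI : `]0, t[ `*` `[0, 1] `<=` (`]0, T[ `*` `[0, 1] : set (R * R)).
      by move=> [r y] [/= /oo_sub ? ?].
    apply: cvgD.
      apply: cvgMr; have : {within `]0, t[ `*` `[0, 1],
          continuous (fun p : R * R => u p.1 p.2)}.
        apply: continuous_subspaceW u_C0 => -[r y] [/= /oo_sub rT ?]; split => //=.
        exact: subset_itv_oo_cc.
      by move=> /subspace_continuousP/(_ (s, x)); apply.
    have /subspace_continuousP/(_ (s, x)) := continuous_subspaceW oo_subI u_dt_C0.
    exact.
  - move=> x x01; rewrite normw// mulr0 expR0 mul1r.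
    by apply: le_trans u0_le; exact: ule.
  - apply: (@filterS2 _ _ (ae_filter_ringOfSetsType (@lebesgue_measure R))
      _ _ _ _ u_C2 u_pde) => s C2s pdes st x x01 xmax Kw.
    have sT := oo_sub s st; have sT' : s \in `]0, t] by exact: subset_itv_oo_oc.
    have sT'' := itvt s sT'.
    have Es := expR_gt0 (zeta * s); have etax := eta_gt0 x x01.
    pose e := Num.sg (u s x); pose V := `|u s x| / eta x.
    have ws : Num.sg (w s x) = e.
      have /gtr0_sg iE : 0 < (eta x)^-1 by rewrite invr_gt0.
      by rewrite /w !sgrM (gtr0_sg Es) mul1r iE mulr1.
    have EV : expR (zeta * s) * V = `|w s x| by rewrite normw.
    have V_ge0 : 0 <= V by rewrite divr_ge0// ltW.
    have e_le1 : `|e| <= 1 by rewrite normr_sg; case: (_ != 0).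
    have ux : e * u s x = V * eta x by rewrite /V divfK ?gt_eqF// /e -normrEsg.
    have ule_V y : y \in `[0, 1] -> e * u s y <= V * eta y.
      move=> y01; rewrite -ler_pdivrMr ?eta_gt0//.
      have := xmax y y01; rewrite !normw// ler_pM2l//; apply: le_trans.
      rewrite ler_pM2r ?invr_gt0 ?eta_gt0//; apply: le_trans (ler_norm _) _.
      by rewrite normrM ler_piMl.
    have VB : B s < V.
      by rewrite -(ltr_pM2l Es) EV; apply: le_lt_trans Kw; exact: B_leK.
    clearbody e V.
    (* A maximizer at an end point would force V below the boundary data. *)
    have x_neq0 : x != 0.
      apply/eqP => x0; move: VB; rewrite ltNge => /negP; apply.
      rewrite x0 in ux.
      by rewrite /B !le_max (le_r_left (u_dx0 s sT'') (eta_d 0 I0) (eta_gt0 0 I0)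
        (g0_gt0 s sT'') (k0_ge1 s sT'') e_le1 V_ge0 ule_V ux).
    have x_neq1 : x != 1.
      apply/eqP => x1; move: VB; rewrite ltNge => /negP; apply.
      rewrite x1 in ux.
      by rewrite /B !le_max (le_r_right (u_dx1 s sT'') (eta_d 1 I1) (eta_gt0 1 I1)
        (g1_gt0 s sT'') (k1_ge1 s sT'') e_le1 V_ge0 ule_V ux) orbT.
    have x_in : x \in `]0, 1[.
      by move: x01; rewrite !in_itv /= !lt_neqAle x_neq1 eq_sym x_neq0.
    have ellip := elliptic_le_at_touching (C2s sT) eta_C2 x_in (a_ge0 _ _ sT x_in)
      V_ge0 (eta_ineq _ _ sT x_in) ule_V ux.
    (* The elliptic terms contribute - sigma * V, the source at most F, and the
       exponential factor zeta * V. *)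
    set F := wnorm eta `]0, 1[ (f s).
    have f_le : e * f s x <= F * eta x.
      rewrite -ler_pdivrMr//; apply: le_trans (fle s x sT'' x_in).
      rewrite ler_pM2r ?invr_gt0//; apply: le_trans (ler_norm _) _.
      by rewrite normrM ler_piMl.
    have EF : expR (zeta * s) * F <= (sigma - zeta) * K.
      have FB : F <= B s * (sigma - zeta).
        by rewrite -ler_pdivrMr// /B le_max lexx orbT.
      apply: (@le_trans _ _ (expR (zeta * s) * B s * (sigma - zeta))).
        by rewrite -mulrA ler_pM2l.
      by rewrite [leRHS]mulrC ler_pM2r//; exact: B_leK.
    rewrite ws /wt (pdes sT x x_in) -EV.
    have -> : e * (expR (zeta * s) * ((zeta * u s x + (a s x * derive1n 2 (u s) x +
        b s x * derive1 (u s) x + c s x * u s x + f s x)) / eta x))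
      = expR (zeta * s) * ((zeta * (e * u s x) + e * (a s x * derive1n 2 (u s) x +
        b s x * derive1 (u s) x + c s x * u s x) + e * f s x) / eta x) by ring.
    apply: (@le_trans _ _ (expR (zeta * s) * (- (sigma - zeta) * V + F))); last lra.
    rewrite ler_pM2l// ler_pdivrMr// ux; lra.
have tT' : t \in `[0, T] by rewrite in_itv /= ltW.
have [x x01 [-> _]] := wnorm_max (uC t tT') eta_C eta_gt0.
have := w_le x x01; rewrite normw// /K mulrC ler_pM2r ?expR_gt0//.
Qed.
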